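(* Every trans-Sasakian generalized $(\kappa,\mu)$-space form is a generalized Sasakian space form. That is, if an almost contact metric manifold $(M,\phi,\xi,\eta,g)$ is trans-Sasakian and is a generalized $(\kappa,\mu)$-space form, then there exist functions $F_1,F_2,F_3$ on $M$ such that $R=F_1R_1+F_2R_2+F_3R_3$.
   Context: All functions and tensors are smooth. An almost contact metric manifold $(M,\phi,\xi,\eta,g)$ is an odd-dimensional Riemannian manifold $(M,g)$ with a $(1,1)$-tensor field $\phi$, a vector field $\xi$ and a 1-form $\eta$ with $\eta(\xi)=1$, $\phi^2X=-X+\eta(X)\xi$, $g(\phi X,\phi Y)=g(X,Y)-\eta(X)\eta(Y)$. It is trans-Sasakian if there are functions $\alpha,\beta$ on $M$ such that $(\nabla_X\phi)Y=\alpha(g(X,Y)\xi-\eta(Y)X)+\beta(g(\phi X,Y)\xi-\eta(Y)\phi X)$ for all $X,Y$. Put $h=\tfrac12 L_\xi\phi$ ($L$ the Lie derivative). The curvature is $R(X,Y)Z=\nabla_X\nabla_YZ-\nabla_Y\nabla_XZ-\nabla_{[X,Y]}Z$. An almost contact metric manifold is a generalized $(\kappa,\mu)$-space form, denoted $M(f_1,\ldots,f_6)$, if there are functions $f_1,\ldots,f_6$ on $M$ with $R=\sum_{i=1}^6 f_iR_i$; it is a generalized Sasakian space form if $R=F_1R_1+F_2R_2+F_3R_3$ for some functions $F_1,F_2,F_3$. Here $R_1(X,Y)Z=g(Y,Z)X-g(X,Z)Y$; $R_2(X,Y)Z=g(X,\phi Z)\phi Y-g(Y,\phi Z)\phi X+2g(X,\phi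 Y)\phi Z$; $R_3(X,Y)Z=\eta(X)\eta(Z)Y-\eta(Y)\eta(Z)X+g(X,Z)\eta(Y)\xi-g(Y,Z)\eta(X)\xi$; $R_4(X,Y)Z=g(Y,Z)hX-g(X,Z)hY+g(hY,Z)X-g(hX,Z)Y$; $R_5(X,Y)Z=g(hY,Z)hX-g(hX,Z)hY+g(\phi hX,Z)\phi hY-g(\phi hY,Z)\phi hX$; $R_6(X,Y)Z=\eta(X)\eta(Z)hY-\eta(Y)\eta(Z)hX+g(hX,Z)\eta(Y)\xi-g(hY,Z)\eta(X)\xi$. *)

(* Defs.v *)
From HB Require Import structures.
From mathcomp Require Import all_boot all_order all_algebra.
From mathcomp Require Import all_classical all_reals all_analysis.
From mathcomp Require Import ring.

Set Implicit Arguments.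
Unset Strict Implicit.
Unset Printing Implicit Defensive.

Import Order.TTheory GRing.Theory Num.Theory.
Import numFieldNormedType.Exports.

Local Open Scope classical_set_scope.
Local Open Scope ring_scope.

Section SmoothMaps.
Context (R : realType) (V : normedModType R).

(* For open U: f is C^k on U when its iterated directional derivatives of
   order at most k exist and are continuous on U. *)
Fixpoint Ck_on (W : normedModType R) (k : nat) (U : set V) (f : V -> W)
    : Prop :=
  (forall x, U x -> {for x, continuous f}) /\
  match k with
  | 0 => True
  | k'.+1 => forall v : V,
      (forall x, U x -> derivable f x v) /\ Ck_on k' U (fun x => 'D_v f x)
  end.

Definition smooth_on (W : normedModType R) (U : set V) (f : V -> W) : Prop :=
  forall k, Ck_on k U f.

Lemma Ck_on_eq (W : normedModType R) k (U : set V) (f g : V -> W) :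
  open U -> (forall x, U x -> f x = g x) -> Ck_on k U f -> Ck_on k U g.
Proof.
move=> oU; have nfg f' g' : (forall x, U x -> f' x = g' x) ->
    forall x, U x -> \forall y \near x, f' y = g' y.
  by move=> fg x Ux; apply: filterS fg _; exact: open_nbhs_nbhs.
have cfg f' g' : (forall x, U x -> f' x = g' x) ->
    (forall x, U x -> {for x, continuous f'}) ->
    forall x, U x -> {for x, continuous g'}.
  move=> fg cf x Ux; suff : g' y @[y --> x] --> g' x by [].
  rewrite -(fg x Ux); apply: cvg_trans (cf x Ux); apply: near_eq_cvg.
  exact: nfg Ux.
elim: k f g => [|k IH] f g fg [cf df]; split=> //; try exact: cfg cf.
move=> v; have [dv Dv] := df v; split.
  by move=> x Ux; apply: near_eq_derivable (dv x Ux); exact: nfg Ux.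
by apply: IH Dv => x Ux; apply: near_eq_derive; exact: nfg Ux.
Qed.

Lemma Ck_onW (W : normedModType R) k (U : set V) (f : V -> W) :
  Ck_on k.+1 U f -> Ck_on k U f.
Proof.
elim: k f => [|k IH] f; first by case.
case=> cf df; split=> // v; have [dv Dv] := df v; split=> //.
exact: IH.
Qed.

Lemma Ck_on_cst (W : normedModType R) k (U : set V) (c : W) :
  open U -> Ck_on k U (cst c).
Proof.
move=> oU; elim: k c => [|k IH] c; split=> //; try by move=> x _; exact: cvg_cst.
move=> v; split; first by move=> x _; exact: derivable_cst.
by apply: (Ck_on_eq oU _ (IH 0)) => x _; rewrite derive_cst.
Qed.

Lemma Ck_onB (W : normedModType R) k (U : set V) (f g : V -> W) :
  open U -> Ck_on k U f -> Ck_on k U g -> Ck_on k U (f - g).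
Proof.
move=> oU; elim: k f g => [|k IH] f g [cf df] [cg dg]; split=> //;
  try by move=> x Ux; apply: cvgB; [exact: cf|exact: cg].
move=> v; have [dfv Dfv] := df v; have [dgv Dgv] := dg v; split.
  by move=> x Ux; apply: derivableB; [exact: dfv|exact: dgv].
apply: (Ck_on_eq oU _ (IH _ _ Dfv Dgv)) => x Ux.
by rewrite deriveB //; [exact: dfv|exact: dgv].
Qed.

Lemma Ck_onD (W : normedModType R) k (U : set V) (f g : V -> W) :
  open U -> Ck_on k U f -> Ck_on k U g -> Ck_on k U (f + g).
Proof.
move=> oU Cf Cg; have -> : f + g = f - (cst 0 - g).
  by apply/funext => x /=; rewrite !fctE sub0r opprK.
by do 2!apply: Ck_onB => //; exact: Ck_on_cst.
Qed.

Lemma Ck_onM k (U : set V) (f g : V -> R^o) :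
  open U -> Ck_on k U f -> Ck_on k U g -> Ck_on k U (f * g).
Proof.
move=> oU; elim: k f g => [|k IH] f g Cf Cg.
  case: Cf Cg => cf _ [cg _]; split=> // x Ux.
  by apply: cvgM; [exact: cf|exact: cg].
have [cf df] := Cf; have [cg dg] := Cg; split=> //.
  by move=> x Ux; apply: cvgM; [exact: cf|exact: cg].
move=> v; have [dfv Dfv] := df v; have [dgv Dgv] := dg v; split.
  by move=> x Ux; apply: derivableM; [exact: dfv|exact: dgv].
apply: (Ck_on_eq oU _ (Ck_onD oU (IH _ _ (Ck_onW Cf) Dgv)
                                 (IH _ _ (Ck_onW Cg) Dfv))) => x Ux.
by rewrite deriveM //; [exact: dfv|exact: dgv].
Qed.

End SmoothMaps.

(* The inverse of a chart is a total function, meaningful on chart_img only. *)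
Record chart (R : realType) (n : nat) (T : topologicalType) := Chart {
  chart_dom : set T;
  chart_img : set 'rV[R]_n;
  chart_fun : T -> 'rV[R]_n;
  chart_inv : 'rV[R]_n -> T;
  chart_dom_open : open chart_dom;
  chart_img_open : open chart_img;
  chart_funS : forall p, chart_dom p -> chart_img (chart_fun p);
  chart_invS : forall x, chart_img x -> chart_dom (chart_inv x);
  chart_funK : forall p, chart_dom p -> chart_inv (chart_fun p) = p;
  chart_invK : forall x, chart_img x -> chart_fun (chart_inv x) = x;
  chart_fun_continuous : forall p, chart_dom p -> {for p, continuous chart_fun};
  chart_inv_continuous : forall x, chart_img x -> {for x, continuous chart_inv}
}.

Arguments chart_dom_open {R n T} c.
Arguments chart_img_open {R n T} c.

Definition smooth_transition (R : realType) (n : nat) (T : topologicalType)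
    (c d : chart R n T) : Prop :=
  smooth_on (chart_img c `&` chart_inv c @^-1` chart_dom d)
            (chart_fun d \o chart_inv c).

Record manifold (R : realType) (n : nat) := Manifold {
  carrier :> topologicalType;
  atlas : set (chart R n carrier);
  manifold_hausdorff : hausdorff_space carrier;
  manifold_second_countable : @second_countable carrier;
  atlas_cover : forall p : carrier, exists2 c, atlas c & chart_dom c p;
  atlas_compat : forall c d, atlas c -> atlas d -> smooth_transition c d
}.

Section SmoothFunctions.
Context (R : realType) (n : nat) (M : manifold R n).

Definition is_smooth (f : M -> R) : Prop :=
  forall c, atlas c ->
    smooth_on (W := R^o) (chart_img c) (f \o chart_inv c).

Definition smooth_pred : {pred M -> R} := fun f => `[< is_smooth f >].

Lemma smooth_subring_closed : subring_closed smooth_pred.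
Proof.
split.
- by apply/asboolP => c _ k; apply: Ck_on_cst; exact: chart_img_open.
- move=> f g /asboolP sf /asboolP sg; apply/asboolP => c ac k.
  by apply: (Ck_on_eq (W := R^o) (chart_img_open c) _
    (Ck_onB (chart_img_open c) (sf c ac k) (sg c ac k))).
- move=> f g /asboolP sf /asboolP sg; apply/asboolP => c ac k.
  by apply: (Ck_on_eq (W := R^o) (chart_img_open c) _
    (Ck_onM (chart_img_open c) (sf c ac k) (sg c ac k))).
Qed.

HB.instance Definition _ :=
  GRing.isSubringClosed.Build (M -> R) smooth_pred smooth_subring_closed.

Record smoothFun := SmoothFun {
  smooth_fun :> M -> R;
  smooth_funP : smooth_fun \in smooth_pred
}.

HB.instance Definition _ := [isSub for smooth_fun].
HB.instance Definition _ := [Choice of smoothFun by <:].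
HB.instance Definition _ :=
  GRing.SubChoice_isSubComPzRing.Build (M -> R) smooth_pred smoothFun
    smooth_subring_closed.

Lemma smooth_cst_subproof (c : R) : (fun _ : M => c) \in smooth_pred.
Proof. by apply/asboolP => d _ k; apply: Ck_on_cst; exact: chart_img_open. Qed.

Definition smooth_cst (c : R) : smoothFun := SmoothFun (smooth_cst_subproof c).

End SmoothFunctions.

Section VectorFields.
Context (R : realType) (n : nat) (M : manifold R n).
Local Notation C := (smoothFun M).

(* A tangent vector at p is an R-linear functional v on C with
   v (f * g) = f p * v g + g p * v f.  A smooth vector field assigns to each p
   a tangent vector X_p so that the function (p |-> X_p f) is smooth for all f
   in C: writing X f for this function, X is a derivation of C, and the value
   X_p is recovered as (f |-> X f p). *)
Definition is_derivation (X : C -> C^o) : Prop :=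
  [/\ forall f g, X (f + g) = X f + X g,
      forall (c : R) f, X (smooth_cst M c * f) = smooth_cst M c * X f &
      forall f g, X (f * g) = f * X g + g * X f].

Definition derivation_pred : {pred C -> C^o} :=
  fun X => `[< is_derivation X >].

Lemma derivation_submod_closed : submod_closed derivation_pred.
Proof.
split.
  have E f : (0 : C -> C^o) f = 0 by [].
  by apply/asboolP; split=> *; rewrite !E ?mulr0 ?addr0.
move=> a X Y /asboolP [XD XZ XM] /asboolP [YD YZ YM]; apply/asboolP.
split=> [f g|c f|f g]; rewrite !fctE /GRing.scale /=.
- by rewrite XD YD mulrDr addrACA.
- by rewrite XZ YZ mulrDr mulrCA.
- by rewrite XM YM !mulrDr addrACA !(mulrCA a).
Qed.

HB.instance Definition _ :=
  GRing.isSubmodClosed.Build C (C -> C^o) derivation_pred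
    derivation_submod_closed.

Record vectorField := VectorField {
  field_fun :> C -> C^o;
  field_funP : field_fun \in derivation_pred
}.

HB.instance Definition _ := [isSub for field_fun].
HB.instance Definition _ := [Choice of vectorField by <:].
HB.instance Definition _ := [SubChoice_isSubLmodule of vectorField by <:].

Lemma lie_bracket_subproof (X Y : vectorField) :
  (fun f => X (Y f) - Y (X f)) \in derivation_pred.
Proof.
case: X Y => [X /asboolP [XD XZ XM]] [Y /asboolP [YD YZ YM]] /=.
apply/asboolP; split=> [f g|c f|f g].
- by rewrite !(XD, YD) opprD addrACA.
- by rewrite !(XZ, YZ) mulrBr.
- rewrite !(XM, YM, XD, YD) !mulrBr.
  set a := f * X (Y g); set b := Y g * X f; set c := g * X (Y f).
  set d := Y f * X g; set e := f * Y (X g); set h := g * Y (X f).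
  by rewrite [X g * Y f]mulrC -/d [X f * Y g]mulrC -/b; ring.
Qed.

Definition lie_bracket (X Y : vectorField) : vectorField :=
  VectorField (lie_bracket_subproof X Y).

End VectorFields.

(* Smooth tensor fields are encoded as maps on vector fields that are linear
   over the ring of smooth functions. *)
Record riemannianMetric (R : realType) (n : nat) (M : manifold R n) :=
  RiemannianMetric {
  metric :> vectorField M -> vectorField M -> smoothFun M;
  metricC : forall X Y : vectorField M, metric X Y = metric Y X;
  metricDl : forall X Y Z : vectorField M,
    metric (X + Y) Z = metric X Z + metric Y Z;
  metricZl : forall (f : smoothFun M) (X Y : vectorField M),
    metric (f *: X) Y = f * metric X Y;
  (* [exists f, X f p <> 0] says that the tangent vector X_p is nonzero *)
  metric_gt0 : forall (X : vectorField M) (p : M),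
    (exists f : smoothFun M, X f p <> 0) -> 0 < metric X X p
}.

Section Connections.
Context (R : realType) (n : nat) (M : manifold R n).
Implicit Types (X Y Z : vectorField M) (f : smoothFun M).

Record is_connection (nabla : vectorField M -> vectorField M -> vectorField M)
    : Prop := IsConnection {
  connDl : forall X Y Z, nabla (X + Y) Z = nabla X Z + nabla Y Z;
  connZl : forall f X Y, nabla (f *: X) Y = f *: nabla X Y;
  connDr : forall X Y Z, nabla X (Y + Z) = nabla X Y + nabla X Z;
  connZr : forall f X Y, nabla X (f *: Y) = X f *: Y + f *: nabla X Y
}.

Record is_levi_civita (g : riemannianMetric M)
    (nabla : vectorField M -> vectorField M -> vectorField M) : Prop :=
  IsLeviCivita {
  lc_connection : is_connection nabla;
  lc_torsion_free : forall X Y, nabla X Y - nabla Y X = lie_bracket X Y;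
  lc_metric : forall X Y Z, X (g Y Z) = g (nabla X Y) Z + g Y (nabla X Z)
}.

Definition curvature (nabla : vectorField M -> vectorField M -> vectorField M)
    X Y Z : vectorField M :=
  nabla X (nabla Y Z) - nabla Y (nabla X Z) - nabla (lie_bracket X Y) Z.

Definition cov_deriv (nabla : vectorField M -> vectorField M -> vectorField M)
    (phi : vectorField M -> vectorField M) X Y : vectorField M :=
  nabla X (phi Y) - phi (nabla X Y).

Definition lie_deriv X (phi : vectorField M -> vectorField M) Y
    : vectorField M :=
  lie_bracket X (phi Y) - phi (lie_bracket X Y).

End Connections.

Record almostContactMetric (R : realType) (n : nat) (M : manifold R n)
    (g : riemannianMetric M) := AlmostContactMetric {
  acm_phi : vectorField M -> vectorField M;
  acm_xi : vectorField M;
  acm_eta : vectorField M -> smoothFun M;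
  acm_phi_linear : linear acm_phi;
  acm_eta_linear : scalar acm_eta;
  acm_odd_dim : odd n;
  acm_eta_xi : acm_eta acm_xi = 1;
  acm_phi2 : forall X : vectorField M,
    acm_phi (acm_phi X) = - X + acm_eta X *: acm_xi;
  acm_phi_metric : forall X Y : vectorField M,
    g (acm_phi X) (acm_phi Y) = g X Y - acm_eta X * acm_eta Y
}.

Section SpaceForms.
Context (R : realType) (n : nat) (M : manifold R n) (g : riemannianMetric M).
Context (S : almostContactMetric g).
Context (nabla : vectorField M -> vectorField M -> vectorField M).
Local Notation phi := (acm_phi S).
Local Notation xi := (acm_xi S).
Local Notation eta := (acm_eta S).
Implicit Types (X Y Z : vectorField M).

Definition trans_sasakian : Prop :=
  exists alpha beta : smoothFun M, forall X Y,
    cov_deriv nabla phi X Y =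
      alpha *: (g X Y *: xi - eta Y *: X)
      + beta *: (g (phi X) Y *: xi - eta Y *: phi X).

Definition acm_h X : vectorField M :=
  smooth_cst M (2^-1) *: lie_deriv xi phi X.
Local Notation h := acm_h.

Definition R1 X Y Z : vectorField M := g Y Z *: X - g X Z *: Y.

Definition R2 X Y Z : vectorField M :=
  g X (phi Z) *: phi Y - g Y (phi Z) *: phi X + (g X (phi Y) *+ 2) *: phi Z.

Definition R3 X Y Z : vectorField M :=
  (eta X * eta Z) *: Y - (eta Y * eta Z) *: X
  + (g X Z * eta Y) *: xi - (g Y Z * eta X) *: xi.

Definition R4 X Y Z : vectorField M :=
  g Y Z *: h X - g X Z *: h Y + g (h Y) Z *: X - g (h X) Z *: Y.

Definition R5 X Y Z : vectorField M :=
  g (h Y) Z *: h X - g (h X) Z *: h Y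
  + g (phi (h X)) Z *: phi (h Y) - g (phi (h Y)) Z *: phi (h X).

Definition R6 X Y Z : vectorField M :=
  (eta X * eta Z) *: h Y - (eta Y * eta Z) *: h X
  + (g (h X) Z * eta Y) *: xi - (g (h Y) Z * eta X) *: xi.

Definition generalized_kappa_mu_space_form : Prop :=
  exists f1 f2 f3 f4 f5 f6 : smoothFun M, forall X Y Z,
    curvature nabla X Y Z =
      f1 *: R1 X Y Z + f2 *: R2 X Y Z + f3 *: R3 X Y Z
      + f4 *: R4 X Y Z + f5 *: R5 X Y Z + f6 *: R6 X Y Z.

Definition generalized_sasakian_space_form : Prop :=
  exists F1 F2 F3 : smoothFun M, forall X Y Z,
    curvature nabla X Y Z =
      F1 *: R1 X Y Z + F2 *: R2 X Y Z + F3 *: R3 X Y Z.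

End SpaceForms.

(* Main.v *)
Require Import Defs.
From mathcomp Require Import all_boot all_algebra all_reals.
From mathcomp Require Import boolp.

(** Applying the trans-Sasakian identity to [xi] gives
    [nabla X xi = - alpha *: phi X + beta *: (X - eta X *: xi)] and
    [nabla xi phi = 0].  As [nabla] is torsion free,
    [2 h X = (nabla xi phi) X - nabla (phi X) xi + phi (nabla X xi)], which
    then vanishes, and with [h = 0] the tensors [R4], [R5], [R6] vanish. *)

Set Implicit Arguments.
Unset Strict Implicit.
Unset Printing Implicit Defensive.

Import GRing.Theory Num.Theory.
Local Open Scope ring_scope.

Section SmoothFunctionRing.
Context (R : realType) (n : nat) (M : manifold R n).
Implicit Types f : smoothFun M.

(** The ring of smooth functions may have zero divisors; it is still reduced, since its elements are
    compared pointwise in the field [R]. *)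
Lemma smooth_fun_sqr_eq0 f : f * f = 0 -> f = 0.
Proof.
move=> /(congr1 (@smooth_fun R n M)) ff0; apply: val_inj; apply: funext => p.
have /eqP : f p * f p = 0 by exact: (congr1 (fun u => u p) ff0).
by rewrite mulf_eq0 orbb => /eqP.
Qed.

Lemma smooth_fun_double_eq0 f : f + f = 0 -> f = 0.
Proof.
move=> /(congr1 (@smooth_fun R n M)) ff0; apply: val_inj; apply: funext => p.
have /eqP : f p + f p = 0 by exact: (congr1 (fun u => u p) ff0).
by rewrite -mulr2n mulrn_eq0 => /eqP.
Qed.

Lemma vectorField1 (X : vectorField M) : X 1 = 0.
Proof.
case: X => X /= /asboolP [_ _ /(_ 1 1)].
by rewrite !mul1r => /esym/(canRL (addrK _)); rewrite subrr.
Qed.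

Lemma metric0l (g : riemannianMetric M) X : g 0 X = 0.
Proof. by rewrite -(scale0r 0) metricZl mul0r. Qed.

End SmoothFunctionRing.

Section AlmostContact.
Context (R : realType) (n : nat) (M : manifold R n) (g : riemannianMetric M).
Context (S : almostContactMetric g).
Local Notation phi := (acm_phi S).
Local Notation xi := (acm_xi S).
Local Notation eta := (acm_eta S).
Implicit Types (X Y : vectorField M) (f : smoothFun M).

Lemma acm_phi0 : phi 0 = 0.
Proof.
have := acm_phi_linear S 1 0 0.
by rewrite !scale1r addr0 => /esym/(canRL (addrK _)); rewrite subrr.
Qed.

Lemma acm_phiD X Y : phi (X + Y) = phi X + phi Y.
Proof. by have := acm_phi_linear S 1 X Y; rewrite !scale1r. Qed.

Lemma acm_phiZ f X : phi (f *: X) = f *: phi X.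
Proof. by have := acm_phi_linear S f X 0; rewrite acm_phi0 !addr0. Qed.

Lemma acm_phiN X : phi (- X) = - phi X.
Proof. by rewrite -scaleN1r acm_phiZ scaleN1r. Qed.

Lemma acm_eta0 : eta 0 = 0.
Proof.
have := acm_eta_linear S 1 0 0.
by rewrite scale1r addr0 mul1r => /esym/(canRL (addrK _)); rewrite subrr.
Qed.

Lemma acm_etaZ f X : eta (f *: X) = f * eta X.
Proof. by have := acm_eta_linear S f X 0; rewrite acm_eta0 !addr0. Qed.

Lemma scale_xi_eq0 f : f *: xi = 0 -> f = 0.
Proof. by move=> /(congr1 eta); rewrite acm_etaZ acm_eta_xi mulr1 acm_eta0. Qed.

(** The values of [phi (phi xi)] and [phi (phi (phi xi))] force [phi xi = e *: xi] with
    [e = eta (phi xi)]; then [phi (phi xi) = 0] reads [(e * e) *: xi = 0]. *)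
Lemma acm_phi_xi : phi xi = 0.
Proof.
have phi2_xi : phi (phi xi) = 0.
  by rewrite acm_phi2 acm_eta_xi scale1r addNr.
have phi_xi : phi xi = eta (phi xi) *: xi.
  have := acm_phi2 S (phi xi); rewrite phi2_xi acm_phi0.
  by move/esym/eqP; rewrite addrC subr_eq0 => /eqP.
suff e0 : eta (phi xi) = 0 by rewrite phi_xi e0 scale0r.
apply/smooth_fun_sqr_eq0/scale_xi_eq0.
by rewrite -scalerA -phi_xi -acm_phiZ -phi_xi.
Qed.

Lemma acm_phi3 X : phi (phi (phi X)) = - phi X.
Proof.
by rewrite (acm_phi2 S X) acm_phiD acm_phiN acm_phiZ acm_phi_xi scaler0 addr0.
Qed.

(** Computing [phi (phi (phi X))] by [acm_phi3] and by [acm_phi2] at [phi X], the results differ by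
    [eta (phi X) *: xi]. *)
Lemma acm_eta_phi X : eta (phi X) = 0.
Proof.
apply: scale_xi_eq0; have := acm_phi2 S (phi X).
by rewrite acm_phi3 -[LHS]addr0 => /addrI/esym.
Qed.

(** Compatibility of [g] with [phi], taken at [Y = xi], has left side zero. *)
Lemma metric_xi X : g X xi = eta X.
Proof.
have := acm_phi_metric S X xi.
rewrite acm_phi_xi acm_eta_xi mulr1 metricC metric0l.
by move/esym/eqP; rewrite subr_eq0 => /eqP.
Qed.

Context (nabla : vectorField M -> vectorField M -> vectorField M).
Hypothesis nabla_lc : is_levi_civita g nabla.

(** The field [xi] has constant length 1: differentiating [g xi xi = 1] gives twice this
    quantity. *)
Lemma eta_nabla_xi X : eta (nabla X xi) = 0.
Proof.
apply: smooth_fun_double_eq0; have := lc_metric nabla_lc X xi xi.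
by rewrite metric_xi acm_eta_xi vectorField1 (metricC _ xi) metric_xi.
Qed.

Lemma lie_deriv_xi_phi X :
  lie_deriv xi phi X =
    cov_deriv nabla phi xi X - nabla (phi X) xi + phi (nabla X xi).
Proof.
rewrite /lie_deriv /cov_deriv -!(lc_torsion_free nabla_lc).
by rewrite acm_phiD acm_phiN opprB addrA addrAC; congr (_ + _); rewrite addrAC.
Qed.

Lemma trans_sasakian_h_eq0 X : trans_sasakian S nabla -> acm_h S X = 0.
Proof.
case=> alpha [beta ts].
have nabla0 Y : nabla Y 0 = 0.
  have := connDr (lc_connection nabla_lc) Y 0 0.
  by rewrite addr0 => /esym/(canRL (addrK _)); rewrite subrr.
(* As [phi xi = 0], the covariant derivative of [phi] along [Y], evaluated at [xi], is
   [- phi (nabla Y xi)]. *)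
have phi_nabla_xi Y :
    phi (nabla Y xi) = - (alpha *: phi (phi Y)) + beta *: phi Y.
  have := ts Y xi; rewrite /cov_deriv !metric_xi acm_phi_xi acm_eta_xi.
  rewrite nabla0 sub0r acm_eta_phi scale0r sub0r !scale1r.
  rewrite [_ *: xi - _]addrC -acm_phi2.
  by move/(canRL opprK) ->; rewrite opprD; congr (_ + _); rewrite scalerN opprK.
(* Since [nabla Y xi] has no [xi] component, applying [- phi] to the previous identity recovers
   it. *)
have nabla_xi Y :
    nabla Y xi = - (alpha *: phi Y) - beta *: phi (phi Y).
  have := acm_phi2 S (nabla Y xi); rewrite eta_nabla_xi scale0r addr0.
  move/esym/(canRL opprK) ->; rewrite phi_nabla_xi acm_phiD acm_phiN !acm_phiZ.
  by rewrite acm_phi3 scalerN opprK opprD.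
(* By [acm_phi3], the formulas for [nabla (phi X) xi] and [phi (nabla X xi)] agree, so these terms
   cancel. *)
rewrite /acm_h lie_deriv_xi_phi ts phi_nabla_xi nabla_xi acm_phi_xi metric0l.
rewrite (metricC _ xi) metric_xi subrr scale0r !scaler0 subr0 scaler0 addr0.
by rewrite acm_phi3 scalerN opprK sub0r addNr scaler0.
Qed.

End AlmostContact.

Theorem theorem5p4 (R : realType) (n : nat) (M : manifold R n)
    (g : riemannianMetric M) (S : almostContactMetric g)
    (nabla : vectorField M -> vectorField M -> vectorField M)
    (nabla_lc : is_levi_civita g nabla) :
  trans_sasakian S nabla ->
  generalized_kappa_mu_space_form S nabla ->
  generalized_sasakian_space_form S nabla.
Proof.
move=> ts [f1 [f2 [f3 [f4 [f5 [f6 curvE]]]]]]; exists f1, f2, f3 => X Y Z.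
have h0 W : acm_h S W = 0 by exact: (trans_sasakian_h_eq0 nabla_lc).
rewrite curvE /R4 /R5 /R6 !h0 acm_phi0 !metric0l !mul0r.
by rewrite !(scale0r, scaler0, subr0, addr0).
Qed.
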